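(* Let $m\ge3$ and $J=(j_1,\dots,j_m)$ a tuple of positive integers. There is a bijection between the set of D-J classes of $\mathbb{Z}_2$-characteristic maps over $P_m(J)$ (equivalently, small covers over $P_m(J)$ up to D-J equivalence) and the set $DJ(m,J)$ of pairs $(\lambda,\mathcal E)$, where $\lambda$ is a D-J class over $P_m$ and $\mathcal E$ is a sequence $(1,S^1_1),\dots,(1,S^1_{j_1-1}),(2,S^2_1),\dots,(2,S^2_{j_2-1}),\dots,(m,S^m_1),\dots,(m,S^m_{j_m-1})$ of e-sets compatible with $\lambda$ that are pairwise $\lambda$-related.
   Context: $P_m$ is the simplicial complex on $[m]$ with facets $\{i,i+1\}$ mod $m$. For a simplicial complex $K$ on $[m]$ and $J\in\mathbb{Z}_{>0}^m$, $K(J)$ has vertex set $\{i_1,\dots,i_{j_i}: i\in[m]\}$ and minimal non-faces $\{(i_1)_1,\dots,(i_1)_{j_{i_1}},\dots,(i_k)_1,\dots,(i_k)_{j_{i_k}}\}$ for each minimal non-face $\{i_1,\dots,i_k\}$ of $K$. A $\mathbb{Z}_2$-characteristic map over an $(n-1)$-dimensional simplicial complex is a map from its vertices to $\mathbb{Z}_2^n$ sending the vertices of every face to linearly independent vectors; two are D-J equivalent if they differ by an element of $GL(n,\mathbb{Z}_2)$. A D-J class over $P_m$ is the same as an unordered weak partition $\lambda=\{\mu_{\mathbf a},\mu_{\mathbf b},\mu_{\mathbf c}\}$ of $[m]$ (parts possibly empty) into non-consecutive sets (no part contains $\{i,i+1 \bmod m\}$); $p,q$ are $\lambda$-equivalent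 if they lie in the same part. An e-set compatible with $\lambda$ is a pair $(p,S)$, $p\in[m]$, $S\subseteq[m]$ of even cardinality, with all elements of $\{p\}\cup S$ mutually $\lambda$-equivalent. For nonempty such $S$, the points of $S$ cut the cycle $[m]$ into $|S|$ nonempty arcs (maximal cyclic intervals of $[m]\setminus S$), colored alternately black/white; for $r\notin S$, $\Omega_r(S)=A\cup S$ where $A$ is the union of black arcs for the coloring in which the arc containing $r$ is white. Two e-sets $(p,S),(q,T)$ compatible with $\lambda$ are $\lambda$-related if either $S=\varnothing$ or $T=\varnothing$ or $p,q$ are $\lambda$-equivalent (type 1), or $S,T\ne\varnothing$, $p,q$ are not $\lambda$-equivalent, and $\Omega_q(S)\cap\Omega_p(T)=\varnothing$ (type 2). *)

(* Defs.v *)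
From HB Require Import structures.
From mathcomp Require Import all_boot all_order all_algebra.
Set Implicit Arguments. Unset Strict Implicit. Unset Printing Implicit Defensive.
Import GRing.Theory.

(* Minimal non-faces of a simplicial complex K (given as a down-closed
   predicate on subsets of the vertex set T). *)
Definition min_nonface (T : finType) (K : {set T} -> bool) (s : {set T}) : bool :=
  ~~ K s && [forall x in s, K (s :\ x)].

Definition Pm_face (m : nat) (s : {set 'I_m}) : bool :=
  (#|s| <= 1) ||
  [exists i : 'I_m, exists j : 'I_m, (s == [set i; j]) && (val j == i.+1 %% m)].

Definition VJ (m : nat) (J : 'I_m -> nat) : finType := {i : 'I_m & 'I_(J i)}.

Definition KJ_face (m : nat) (J : 'I_m -> nat) (K : {set 'I_m} -> bool)
    (t : {set VJ J}) : bool :=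
  [forall w : {set 'I_m},
     min_nonface K w ==> ~~ ([set v : VJ J | tag v \in w] \subset t)].

Definition PmJ_face (m : nat) (J : 'I_m -> nat) (t : {set VJ J}) : bool :=
  @KJ_face m J (@Pm_face m) t.

(* P_m(J) has dimension 1 + sum (j_i - 1), so characteristic maps go to Z_2^n. *)
Definition nJ (m : nat) (J : 'I_m -> nat) : nat := (\sum_(i < m) (J i).-1).+2.

Definition charmap (m : nat) (J : 'I_m -> nat)
    (l : {ffun VJ J -> 'rV['F_2]_(nJ J)}) : bool :=
  [forall t : {set VJ J}, PmJ_face t ==> free (map l (enum t))].

Definition dj_equiv (m : nat) (J : 'I_m -> nat)
    (l mu : {ffun VJ J -> 'rV['F_2]_(nJ J)}) : bool :=
  [exists A : 'M['F_2]_(nJ J), (A \in unitmx) && [forall v, mu v == (l v *m A)%R]].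

Definition charmaps (m : nat) (J : 'I_m -> nat) : {set {ffun VJ J -> 'rV['F_2]_(nJ J)}} :=
  [set l | charmap l].

Definition DJclasses (m : nat) (J : 'I_m -> nat)
    : {set {set {ffun VJ J -> 'rV['F_2]_(nJ J)}}} :=
  [set [set mu in charmaps J | dj_equiv l mu] | l in charmaps J].

(* An unordered weak partition of [m] into 3 non-consecutive parts, represented
   by its set of nonempty parts. *)
Definition Pm_class (m : nat) (P : {set {set 'I_m}}) : bool :=
  [&& partition P [set: 'I_m], #|P| <= 3 &
      [forall B in P, forall i : 'I_m, forall j : 'I_m,
         ~~ [&& i \in B, j \in B & val j == i.+1 %% m]]].

Definition lequiv (m : nat) (P : {set {set 'I_m}}) (p q : 'I_m) : bool :=
  [exists B in P, (p \in B) && (q \in B)].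

Definition eset_compat (m : nat) (P : {set {set 'I_m}}) (p : 'I_m) (S : {set 'I_m}) : bool :=
  ~~ odd #|S| && [forall x in p |: S, forall y in p |: S, lequiv P x y].

Definition cdist (m : nat) (r x : 'I_m) : nat := (x + m - r) %% m.

(* Omega_r(S): S together with the black arcs, where the arc containing r is
   white; an element x not in S lies on a black arc iff an odd number of points
   of S are met going cyclically from r to x. *)
Definition Omega (m : nat) (r : 'I_m) (S : {set 'I_m}) : {set 'I_m} :=
  S :|: [set x | (x \notin S) && odd #|[set s in S | cdist r s < cdist r x]|].

Definition lrelated (m : nat) (P : {set {set 'I_m}})
    (p : 'I_m) (S : {set 'I_m}) (q : 'I_m) (T : {set 'I_m}) : bool :=
  [|| S == set0, T == set0, lequiv P p q
    | [&& S != set0, T != set0, ~~ lequiv P p q & Omega q S :&: Omega p T == set0]].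

Definition Idx (m : nat) (J : 'I_m -> nat) : finType := {i : 'I_m & 'I_(J i).-1}.

Definition DJpair (m : nat) (J : 'I_m -> nat)
    (x : {set {set 'I_m}} * {ffun Idx J -> {set 'I_m}}) : bool :=
  let P := x.1 in let E := x.2 in
  [&& Pm_class P,
      [forall a, eset_compat P (tag a) (E a)] &
      [forall a, forall b, (a != b) ==> lrelated P (tag a) (E a) (tag b) (E b)]].

Definition DJset (m : nat) (J : 'I_m -> nat)
    : {set {set {set 'I_m}} * {ffun Idx J -> {set 'I_m}}} :=
  [set x | DJpair x].

(* Main.v *)
(* A characteristic map over P_m(J) is determined up to D-J equivalence by its
   kernel. In a suitable basis it sends every vertex over i other than a chosen one
   to a basis vector, so that it is given by a colouring lam of the polygon
   by nonzero vectors of F_2^2 and, for every additional vertex a, a vector V a of F_2^m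
   modulo the rows of lam. It is a characteristic map iff for every nonempty
   set u with zero lam-sum, the set of those i in u such that all additional
   vertices a over i satisfy sum_u V a = 1 is not a face of P_m.

   For one additional vertex over p this means that, modulo the rows of lam,
   V a is e_p plus the indicator of the black arcs cut out by an even set S in the part of p.
   For several of them, fix an edge {i, i + 1} and let (q, S) point to r when r is not
   equivalent to q and S separates r from the edge. Being pairwise related
   amounts to the absence of 2-cycles for all edges; then the part of the
   cycle that S cuts off from the edge strictly decreases along arrows, so there
   are no cycles at all, and a set u violating the criterion, in which every point
   outside the edge has an outgoing arrow, cannot exist. *)
Require Import Defs.
From HB Require Import structures.
From mathcomp Require Import all_boot all_order all_algebra.
From mathcomp Require Import zify.
Set Implicit Arguments. Unset Strict Implicit. Unset Printing Implicit Defensive.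
Import GRing.Theory.

(** * Parity of the points of a set on the cycle, and [Omega] in terms of it *)

Section Cycle.
Variable m : nat.
Implicit Types (S T : {set 'I_m}) (i x r : 'I_m).

(** A linear count from 0 in place of the cyclic count in [Omega]. For even [S] it is constant on
    arcs and flips just after each point of [S], so a point of [S] is counted with the arc before
    it. *)
Definition side S x : bool := odd #|[set s in S | s < x]|.

Lemma side0 x : side set0 x = false.
Proof.
by rewrite /side (_ : [set s in set0 | _] = set0) ?cards0 //; apply/setP=> s; rewrite !inE.
Qed.

Lemma odd_card_leq S i : odd #|[set s in S | s < i.+1]| = side S i (+) (i \in S).
Proof.
rewrite /side; case: (boolP (i \in S)) => iS.
  have -> : [set s in S | s < i.+1] = i |: [set s in S | s < i].
    apply/setP=> s; rewrite !inE ltnS leq_eqVlt andb_orr -val_eqE.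
    by case: (eqVneq s i) => [->|]; rewrite ?eqxx ?iS //= => /negPf; rewrite -val_eqE /= => ->; rewrite andbF.
  by rewrite cardsU1 !inE iS ltnn /= addbT.
rewrite addbF; congr (odd _); apply: eq_card=> s; rewrite !inE ltnS leq_eqVlt.
by case: (eqVneq s i) => [->|]; rewrite ?eqxx ?(negPf iS) //= => /negPf; rewrite -val_eqE /= => ->.
Qed.

(** At the last index [ordS i] is 0 and the count starts afresh; the evenness of [S] makes the rule
    hold there too. *)
Lemma side_ordS S i : ~~ odd #|S| -> side S (ordS i) = side S i (+) (i \in S).
Proof.
move=> evS; rewrite -odd_card_leq; have := ltn_ord i; rewrite leq_eqVlt => /orP[/eqP im|im].
  rewrite {1}/side [X in odd X = _](_ : _ = 0); last first.
    by apply/eqP; rewrite cards_eq0; apply/eqP/setP=> s; rewrite !inE /= im modnn andbF.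
  rewrite (_ : [set s in S | s < i.+1] = S) ?(negPf evS) //.
  by apply/setP=> s; rewrite !inE im ltn_ord andbT.
by rewrite /side /= modn_small.
Qed.

Lemma side_ord_pred S i : ~~ odd #|S| -> ord_pred i \notin S ->
  side S (ord_pred i) = side S i.
Proof.
by move=> evS /negPf iS; rewrite -{2}[i]ord_predK side_ordS // iS addbF.
Qed.

(** If [r <= x], the points of [S] met from [r] to [x] are those below [x] less those below [r]. If
    [x < r], the way passes through 0 and meets the complement in [S] of the points between [x] and
    [r], which has the same parity as these since [S] is even. *)
Lemma Omega_side S r x : ~~ odd #|S| -> r \notin S ->
  (x \in Omega r S) = (x \in S) || (side S x != side S r).
Proof.
move=> evS rS; rewrite !inE; case: (boolP (x \in S)) => //= xS.
have cd (y : 'I_m) : cdist r y = if r <= y then y - r else y + m - r.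
  rewrite /cdist; case: leqP => ry.
    by rewrite addnC -addnBA // modnDl modn_small //; have := ltn_ord y; lia.
  by rewrite modn_small //; have := ltn_ord r; lia.
have lem (P Q : pred 'I_m) : (forall s, s \in S -> P s -> ~~ Q s) ->
    #|[set s in S | P s || Q s]| = #|[set s in S | P s]| + #|[set s in S | Q s]|.
  move=> PQ; rewrite -cardsUI [X in _ = _ + X](_ : _ = 0) ?addn0; last first.
    apply/eqP; rewrite cards_eq0; apply/eqP/setP=> s; rewrite !inE.
    by case: (boolP (s \in S)) => //= sS; case: (boolP (P s)) => //= /(PQ _ sS) /negPf.
  by apply: eq_card => s; rewrite !inE andb_orr.
have neqS s y : s \in S -> y \notin S -> val s <> val y.
  by move=> sS yS /val_inj e; rewrite -e sS in yS.
case: (leqP r x) => rx.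
  have := lem (fun s => s < r) (fun s => cdist r s < cdist r x).
  rewrite (_ : [set s in S | _ || _] = [set s in S | s < x]); last first.
    apply/setP=> s; rewrite !inE; case: (boolP (s \in S)) => //= sS.
    rewrite !cd rx; have := neqS _ _ sS rS; have := neqS _ _ sS xS.
    by have := ltn_ord x; have := ltn_ord s; have := ltn_ord r; case: (leqP r s) => /=; lia.
  rewrite /side => -> => [|s sS]; first by rewrite oddD; case: (odd _) (odd _) => [] [].
  by rewrite !cd rx; have := ltn_ord x; case: (leqP r s) => /=; lia.
have := lem (fun s => cdist r s < cdist r x) (fun s => (x < s) && (s < r)).
rewrite (_ : [set s in S | _ || _] = S); last first.
  apply/setP=> s; rewrite !inE; case: (boolP (s \in S)) => //= sS.
  rewrite !cd [r <= x]leqNgt rx /=; have := neqS _ _ sS rS; have := neqS _ _ sS xS.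
  by have := ltn_ord x; have := ltn_ord s; have := ltn_ord r; case: (leqP r s) => /=; lia.
move=> eS; have := lem (fun s => s < x) (fun s => (x < s) && (s < r)).
rewrite (_ : [set s in S | _ || _] = [set s in S | s < r]); last first.
  apply/setP=> s; rewrite !inE; case: (boolP (s \in S)) => //= sS.
  by have := neqS _ _ sS xS; case: (ltngtP s x) => /= sx; rewrite ?orbF; lia.
rewrite /side => -> => [|s sS]; last by lia.
move: evS; rewrite eS => [|s sS]; first by rewrite !oddD; do 3! case: (odd _).
by rewrite !cd [r <= x]leqNgt rx /=; have := ltn_ord x; case: (leqP r s) => /=; lia.
Qed.

End Cycle.

(** * The plane F_2^2 of colours and its alternating form *)

Local Notation color := ('F_2 * 'F_2)%type.

Section Colors.
Local Open Scope ring_scope.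

Lemma F2P (x : 'F_2) : x = 0 \/ x = 1.
Proof. by case: x => [[|[|//]] h]; [left|right]; apply/val_inj. Qed.

Lemma addF2_0 (x y : 'F_2) : (x + y == 0) = (x == y).
Proof. by case: (F2P x) => ->; case: (F2P y) => ->. Qed.

Lemma F2_eq1 (x y : 'F_2) : (x == 1) = (y == 1) -> x = y.
Proof. by case: (F2P x) => ->; case: (F2P y) => ->. Qed.

Lemma natF2_addb (b c : bool) : (b (+) c)%:R = b%:R + c%:R :> 'F_2.
Proof. by apply/eqP; case: b c => [] []. Qed.

Lemma natF2_neq0 (x : 'F_2) : (x != 0)%:R = x.
Proof. by case: (F2P x) => ->. Qed.

Lemma addcc (a : color) : a + a = 0.
Proof. by case: a => a b; apply/eqP; case: (F2P a) => ->; case: (F2P b) => ->. Qed.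

Lemma addc_eq0 (a b : color) : (a + b == 0) = (a == b).
Proof. by case: a b => [a a'] [b b']; rewrite !xpair_eqE !addF2_0. Qed.

Lemma color_span (a b z : color) : a != 0 -> b != 0 -> a != b ->
  [|| z == 0, z == a, z == b | z == a + b].
Proof.
case: a b z => [a a'] [b b'] [z z'].
case: (F2P a) => ->; case: (F2P a') => ->; case: (F2P b) => ->; case: (F2P b') => ->;
by case: (F2P z) => ->; case: (F2P z') => ->.
Qed.

(** The determinant. Every linear functional on colours is [omega z] for some [z], and on nonzero
    colours the form tests inequality. *)
Definition omega (a b : color) : 'F_2 := a.1 * b.2 + a.2 * b.1.

Lemma omega_neq (a b : color) : a != 0 -> b != 0 -> omega a b = (a != b)%:R.
Proof.
case: a b => [a a'] [b b'].
by case: (F2P a) => ->; case: (F2P a') => ->; case: (F2P b) => ->; case: (F2P b') => -> //= _ _;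
   apply/eqP.
Qed.

Lemma omegaC (a b : color) : omega a b = omega b a.
Proof. by rewrite /omega addrC mulrC [a.1 * _]mulrC. Qed.

Lemma omegaDl (a b c : color) : omega (a + b) c = omega a c + omega b c.
Proof. by rewrite /omega /= !mulrDl addrACA. Qed.

Lemma omegaDr (a b c : color) : omega c (a + b) = omega c a + omega c b.
Proof. by rewrite omegaC omegaDl ![omega _ c]omegaC. Qed.

Lemma omega0 (a : color) : omega a 0 = 0.
Proof. by rewrite /omega /= !mulr0 addr0. Qed.

Lemma omega_sum (I : finType) (u : {set I}) (F : I -> color) (a : color) :
  omega a (\sum_(r in u) F r) = \sum_(r in u) omega a (F r).
Proof. exact: (big_morph (omega a) (fun x y => omegaDr x y a) (omega0 a)). Qed.

Lemma omega_surj (a : color) (c : 'F_2) : a != 0 -> exists z, omega z a = c.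
Proof.
case: a => a b ab0; case: (F2P c) => ->; first by exists 0; rewrite omegaC omega0.
case: (F2P b) ab0 => [->|->]; case: (F2P a) => [->|->] // _.
- by exists (0, 1); apply/eqP.
- by exists (1, 0); apply/eqP.
- by exists (1, 0); apply/eqP.
Qed.

Lemma sum_eqF2 (I : finType) (u : {set I}) (p : I) :
  \sum_(r in u) (r == p)%:R = (p \in u)%:R :> 'F_2.
Proof.
rewrite big_mkcond (bigD1 p) //= eqxx big1 ?addr0 => [|r /negPf ->]; last by rewrite if_same.
by case: (p \in u).
Qed.

(** * Colourings of the cycle, null sets and Gale vectors *)

Section Coloring.
Variables (m : nat) (lam : 'I_m -> color).
Implicit Types (S T u : {set 'I_m}) (i p q r : 'I_m).

(** This is a characteristic map over [P_m]: two vectors over F_2 are independent iff they are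
    nonzero and distinct. *)
Definition proper_coloring := forall i, lam i != 0 /\ lam i != lam (ordS i).

Definition null u : bool := \sum_(r in u) lam r == 0.

(* The vector that the e-set (p, S) assigns to a new vertex over p in the
   Gale dual: e_p plus the indicator of the black arcs of S outside the part of p,
   the black arcs being those not containing 0. *)
Definition gale p S r : 'F_2 :=
  (r == p)%:R + omega (lam p) (lam r) * (side S r)%:R.

Hypothesis lam_proper : proper_coloring.

Lemma lam_neq0 i : lam i != 0. Proof. by case: (lam_proper i). Qed.
Lemma lam_ordS i : lam i != lam (ordS i). Proof. by case: (lam_proper i). Qed.
Lemma neq_ordS i : i != ordS i.
Proof. by apply: contraNneq (lam_ordS i) => <-. Qed.

Lemma omega_lam p r : omega (lam p) (lam r) = (lam p != lam r)%:R.
Proof. by rewrite omega_neq ?lam_neq0. Qed.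

(** Over a null set a constant multiple of [omega (lam p) (lam r)] sums to zero, so sides may be
    measured from [ordS i] instead of 0. The edge then contributes nothing: [i] differs in side from
    [ordS i] only if it lies in [S], and then it has the colour of [p]. *)
Lemma gale_sum p S u i : null u -> ~~ odd #|S| -> {in S, forall s, lam s = lam p} ->
  \sum_(r in u) gale p S r = (p \in u)%:R
    + \sum_(r in u :\: [set i; ordS i])
        ((lam p != lam r) && (side S r != side S (ordS i)))%:R.
Proof.
move=> /eqP u0 evS Sp; rewrite /gale big_split sum_eqF2 /=; congr (_ + _).
have e0 : \sum_(r in u) omega (lam p) (lam r) * (side S (ordS i))%:R = 0.
  by rewrite -mulr_suml -omega_sum u0 omega0 mul0r.
rewrite -[LHS]addr0 -[X in _ + X = _]e0 -big_split (big_setID [set i; ordS i]) /=.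
rewrite big1 ?add0r => [|r]; last first.
  rewrite !inE -mulrDr -natF2_addb omega_lam => /andP[_ /orP[]/eqP ->]; last by rewrite addbb mulr0.
  rewrite side_ordS // addKb; case: (boolP (i \in S)) => [/Sp->|]; last by rewrite mulr0.
  by rewrite eqxx mul0r.
apply: eq_bigr => r _; rewrite -mulrDr -natF2_addb omega_lam.
by case: (side S r) (side S (ordS i)) (lam p != lam r) => [] [] []; apply/eqP.
Qed.

Lemma null_edge u i : null u -> u \subset [set i; ordS i] -> u = set0.
Proof.
move=> u0 /subsetP ui; have [i0 iS] := lam_proper i; have [j0 _] := lam_proper (ordS i).
have sumE : \sum_(r in u) lam r = (if i \in u then lam i else 0) + (if ordS i \in u then lam (ordS i) else 0).
  rewrite big_mkcond (bigD1 i) //= (bigD1 (ordS i)) 1?eq_sym ?neq_ordS //=.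
  rewrite big1 ?addr0 // => r /andP[/negPf ri /negPf rj].
  by case: ifP => // /ui; rewrite !inE ri rj.
apply/setP=> r; rewrite inE; apply/negP=> ru.
move: u0; rewrite /null sumE; have := ui r ru; rewrite !inE => /orP[] /eqP e; rewrite -!e ru.
- case: ifP => _; last by rewrite addr0 e (negPf i0).
  by rewrite addc_eq0 e (negPf iS).
- case: ifP => _; last by rewrite add0r e (negPf j0).
  by rewrite addc_eq0 e (negPf iS).
Qed.

(** The colours of the two ends of an edge span the plane, so some subset of the edge cancels the
    sum over [A]. *)
Lemma null_extend (A : {set 'I_m}) i : [disjoint A & [set i; ordS i]] ->
  exists2 u : {set 'I_m}, null u & u :\: [set i; ordS i] = A.
Proof.
move=> dA; pose B (T : {set 'I_m}) := A :|: T.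
have BD T : T \subset [set i; ordS i] -> B T :\: [set i; ordS i] = A.
  move=> Ti; rewrite setDUl (setDidPl _) // (_ : T :\: _ = set0) ?setU0 //.
  by apply/eqP; rewrite setD_eq0.
have Bsum T : T \subset [set i; ordS i] ->
    \sum_(r in B T) lam r = \sum_(r in A) lam r + \sum_(r in T) lam r.
  move=> Ti; rewrite -bigU /=; first by apply: eq_bigl => r; rewrite !inE.
  exact: disjointWr Ti dA.
have [i0 iS] := lam_proper i; have [j0 _] := lam_proper (ordS i).
suff [T Ti eT] : exists2 T : {set 'I_m}, T \subset [set i; ordS i]
    & \sum_(r in T) lam r = \sum_(r in A) lam r.
  by exists (B T); [rewrite /null Bsum // eT addcc | apply: BD].
case/or4P: (color_span (\sum_(r in A) lam r) i0 j0 iS) => /eqP ->.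
- by exists set0; rewrite ?sub0set ?big_set0.
- by exists [set i]; rewrite ?big_set1 // sub1set !inE eqxx.
- by exists [set ordS i]; rewrite ?big_set1 // sub1set !inE eqxx orbT.
- by exists [set i; ordS i]; rewrite // big_setU1 ?inE ?neq_ordS //= big_set1.
Qed.

(** Whether [s] lies in [S] is read off a null set that consists of [ordS s] alone outside the edge
    of [ord_pred s] and [s]: there [gale_sum] compares the sides just before and just after [s]. *)
Lemma gale_inj p S T : ~~ odd #|S| -> ~~ odd #|T| ->
  {in S, forall s, lam s = lam p} -> {in T, forall s, lam s = lam p} ->
  (forall i, i != ordS (ordS i)) ->
  (forall u, null u -> \sum_(r in u) gale p S r = \sum_(r in u) gale p T r) -> S = T.
Proof.
move=> evS evT Sp Tp m3 eqST; apply/setP=> s.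
have [lps|lps] := eqVneq (lam p) (lam s); last first.
  by apply/idP/idP => [/Sp|/Tp] e; rewrite e eqxx in lps.
have [u u0 uE] : exists2 u : {set 'I_m}, null u
    & u :\: [set ord_pred s; ordS (ord_pred s)] = [set ordS s].
  apply: null_extend; rewrite disjoints1 !inE ord_predK negb_or [_ == s]eq_sym neq_ordS.
  by have := m3 (ord_pred s); rewrite ord_predK eq_sym => ->.
have /eqP := eqST u u0; rewrite !(@gale_sum _ _ _ (ord_pred s)) // uE !big_set1 ord_predK.
rewrite !side_ordS // lps lam_ordS /=.
by case: (side S s) (side T s) (s \in S) (s \in T) (p \in u) => [] [] [] [] [].
Qed.

End Coloring.
End Colors.

(** * The edges of the polygon *)

Section Polygon.
Variable m : nat.
Hypothesis m_gt2 : 2 < m.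
Implicit Types (i : 'I_m) (s u : {set 'I_m}).

Lemma ordS_ordS i : i != ordS (ordS i).
Proof.
rewrite -val_eqE /=; have im := ltn_ord i.
have [im1|] := eqVneq i.+1 m; first by rewrite im1 modnn modn_small; lia.
move=> im1; rewrite (modn_small (_ : i.+1 < m)); last by lia.
have [im2|im2] := eqVneq i.+2 m; first by rewrite im2 modnn; lia.
by rewrite modn_small; lia.
Qed.

Lemma Pm_faceP s : reflect (exists i, s \subset [set i; ordS i]) (Pm_face s).
Proof.
apply: (iffP orP) => [[|/existsP[i /existsP[j /andP[/eqP-> /eqP ij]]]]|[i si]].
- rewrite leq_eqVlt ltnS leqn0 cards_eq0 => /orP[/cards1P[x ->]|/eqP ->].
    by exists x; rewrite sub1set !inE eqxx.
  by exists (Ordinal (ltn_trans (isT : 0 < 2) m_gt2)); rewrite sub0set.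
- by exists i; rewrite (_ : j = ordS i) //; apply: val_inj.
have [->|ns] := eqVneq s [set i; ordS i].
  by right; apply/existsP; exists i; apply/existsP; exists (ordS i); rewrite !eqxx.
left; rewrite -ltnS (leq_trans (proper_card (_ : s \proper [set i; ordS i]))) //.
  by rewrite properEneq ns.
by rewrite cards2 ltnS leq_b1.
Qed.

End Polygon.

(** * The criterion for characteristic maps and its translation into e-sets *)

Section Good.
Variables (m : nat) (m_gt2 : 2 < m) (J : 'I_m -> nat).
Variables (lam : 'I_m -> color).
Implicit Types (i p q r x : 'I_m) (u S T : {set 'I_m}) (a b : Idx J).
Implicit Types (V : Idx J -> 'I_m -> 'F_2) (E : {ffun Idx J -> {set 'I_m}}).

(** The points all of whose vertices in [P_m(J)] belong to the kernel set with base [u]; see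
    [standard_face]. *)
Definition full V u : {set 'I_m} :=
  [set i in u | [forall a : Idx J, (tag a == i) ==> (\sum_(r in u) V a r == 1)%R]].

Definition good V := forall u, u != set0 -> null lam u -> ~~ Pm_face (full V u).

Definition eset_of p S := ~~ odd #|S| /\ {in S, forall s, lam s = lam p}.

Definition disjoint_Omega p S q T :=
  lam p != lam q -> S != set0 -> T != set0 -> Omega q S :&: Omega p T = set0.

Lemma full_sub V u : full V u \subset u.
Proof. by apply/subsetP=> r; rewrite inE => /andP[]. Qed.

(** Otherwise [[set i]] or [[set i; ordS i]] is a nonempty null set inside an edge, and so is its
    full part. *)
Lemma good_coloring V : good V -> proper_coloring lam.
Proof.
move=> gV i; have noface u : u != set0 -> null lam u -> ~~ (u \subset [set i; ordS i]).
  move=> un0 u0; apply: contra (gV u un0 u0) => ui; apply/(Pm_faceP m_gt2).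
  by exists i; apply: subset_trans (full_sub V u) ui.
split; apply: contraT; rewrite negbK => li.
  have := noface [set i]; rewrite /null big_set1 li sub1set !inE eqxx; apply => //.
  by apply/set0Pn; exists i; rewrite inE.
have := noface [set i; ordS i]; rewrite subxx; apply.
  by apply/set0Pn; exists i; rewrite !inE eqxx.
rewrite /null big_setU1 ?big_set1 /= ?addc_eq0 // inE.
by apply/negP=> /eqP e; have := ordS_ordS m_gt2 i; rewrite -!e eqxx.
Qed.

(** A functional of [lam] sums to zero over a null set, so each [V a] matters only modulo such
    functionals. *)
Lemma full_shift V V' (z : Idx J -> color) u : null lam u ->
  (forall a r, V' a r = V a r + omega (z a) (lam r))%R -> full V' u = full V u.
Proof.
move=> /eqP u0 VV'; apply/setP=> r; rewrite !inE; congr (_ && _).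
apply: eq_forallb => a; congr (_ ==> (_ == _)).
by rewrite (eq_bigr _ (fun r _ => VV' a r)) big_split /= -omega_sum u0 omega0 addr0.
Qed.

Lemma good_shift V V' (z : Idx J -> color) :
  (forall a r, V' a r = V a r + omega (z a) (lam r))%R -> good V -> good V'.
Proof. by move=> VV' gV u un0 u0; rewrite (full_shift u0 VV'); apply: gV. Qed.

Hypothesis lam_proper : proper_coloring lam.

(** A null set [u] whose full part lies in an edge has a bad vertex over each of its points outside
    the edge. A bad vertex with the smallest [far] set then points to another bad one with a
    strictly smaller [far] set. *)
Lemma good_gale E :
  (forall a, eset_of (tag a) (E a)) ->
  (forall a b, disjoint_Omega (tag a) (E a) (tag b) (E b)) ->
  good (fun a => gale lam (tag a) (E a)).
Proof.
move=> evE relE u un0 u0; apply/negP=> /(Pm_faceP m_gt2)[i Fi].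
pose Q := u :\: [set i; ordS i].
pose bad := [set a : Idx J | (tag a \in Q) && (\sum_(r in u) gale lam (tag a) (E a) r != 1)%R].
have Qbad q : q \in Q -> exists2 a, a \in bad & tag a = q.
  move=> qQ; have : q \notin full (fun a => gale lam (tag a) (E a)) u.
    by apply: contraTN qQ => /(subsetP Fi); rewrite /Q !inE => ->.
  rewrite inE; have -> /= : q \in u by move: qQ; rewrite !inE => /andP[].
  rewrite negb_forall => /existsP[a]; rewrite negb_imply => /andP[/eqP qa Va].
  by exists a => //; rewrite inE Va qa qQ.
have [a0 a0P] : exists a, a \in bad.
  have [q qQ] : exists q, q \in Q.
    apply/set0Pn; apply: contra un0; rewrite setD_eq0 => ui.
    by apply/eqP; apply: null_edge u0 ui.
  by have [a] := Qbad q qQ; exists a.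
(* What [E a] cuts off from the edge, with the points of [E a] included; [ordS i] stands for the
   edge, as in [gale_sum]. *)
pose far a := [set x | (x \in E a) || (side (E a) x != side (E a) (ordS i))].
have [a aP amin] := arg_minnP (fun a => #|far a|) a0P.
have [ev_a Ea] := evE a.
(* Since [tag a] is in [u], the sum is 1 plus a sum over [Q]; as it is not 1, some term over [Q] is
   nonzero, and this gives the arrow from [a] to [r]. *)
have [r rQ /andP[car rfar]] : exists2 r, r \in Q
    & (lam (tag a) != lam r) && (side (E a) r != side (E a) (ordS i)).
  have : a \in bad := aP. rewrite inE => /andP[aQ]; rewrite (gale_sum lam_proper i u0) //.
  have -> /= : tag a \in u by move: aQ; rewrite !inE => /andP[].
  rewrite -[X in _ != X]addr0 (inj_eq (addrI _)) => sn0.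
  apply/exists_inP; apply: contraR sn0; rewrite negb_exists_in => /forall_inP H.
  by rewrite big1 // => r /H /negPf ->.
have [b bP rb] := Qbad r rQ; have [ev_b Eb] := evE b.
have rS : r \notin E a by apply: contra car => /Ea ->.
have Ea0 : E a != set0.
  by apply: contraNneq rfar => ->; rewrite !side0.
suff : far b \proper far a by move=> /proper_card; rewrite ltnNge (amin b bP).
have [Eb0|Eb0] := eqVneq (E b) set0.
  have -> : far b = set0.
    by apply/setP=> z; rewrite !inE Eb0 inE !side0.
  by rewrite proper0; apply/set0Pn; exists r; rewrite inE rfar orbT.
have dO : Omega r (E a) :&: Omega (tag a) (E b) = set0.
  by rewrite -rb; apply: relE => //; rewrite rb.
have aT : tag a \notin E b by apply: contra car => /Eb ->; rewrite rb.
have dOP z : (z \in E a) || (side (E a) z != side (E a) r) ->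
    ~~ ((z \in E b) || (side (E b) z != side (E b) (tag a))).
  by rewrite -!Omega_side // => zO; apply/negP=> zO'; have := in_set0 z; rewrite -dO inE zO zO'.
(* [E a] separates [ordS i] from [r], so [ordS i] is in the first [Omega] and hence not in the
   second. *)
have side_a : side (E b) (ordS i) = side (E b) (tag a).
  have := dOP (ordS i); rewrite [side _ (ordS i) == _]eq_sym rfar orbT => /(_ isT).
  by rewrite negb_or negbK => /andP[_ /eqP].
(* A point outside [far a] is separated from [r] by [E a], so it avoids the second [Omega], which is
   [far b] by [side_a]. The points of [E a] make the inclusion strict. *)
apply/properP; split.
  apply/subsetP=> z; rewrite !inE side_a => zb; apply: contraTT zb; rewrite negb_or negbK => /andP[za /eqP zi].
  by apply: dOP; rewrite zi [_ == side _ r]eq_sym rfar orbT.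
have [s sE] := set0Pn _ Ea0; exists s; rewrite !inE ?sE // side_a.
by apply: dOP; rewrite sE.
Qed.

Lemma full_sub_edge V u i : 
  (forall r, r \in u :\: [set i; ordS i] ->
    exists2 a, tag a = r & \sum_(r in u) V a r != 1)%R ->
  full V u \subset [set i; ordS i].
Proof.
move=> H; apply/subsetP=> r; rewrite [r \in _]inE => /andP[ru /forallP fr].
apply/negPn/negP=> ri; have [|a ar] := H r; first by rewrite inE ri.
by have := fr a; rewrite ar eqxx => /= /eqP ->; rewrite eqxx.
Qed.

(** Here [tag a] is the only point of [u] outside the edge, so a sum other than 1 would put the full
    part inside the edge. *)
Lemma good_row V a i u : good V -> tag a \notin [set i; ordS i] ->
  null lam u -> u :\: [set i; ordS i] = [set tag a] -> (\sum_(r in u) V a r = 1)%R.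
Proof.
move=> gV ai u0 uE; apply/eqP/negPn/negP=> Va.
have au : tag a \in u by have := set11 (tag a); rewrite -uE inE => /andP[].
have un0 : u != set0 by apply/set0Pn; exists (tag a).
apply: (negP (gV u un0 u0)); apply/(Pm_faceP m_gt2); exists i; apply: full_sub_edge => r; rewrite uE inE => /eqP ->.
by exists a.
Qed.

Lemma sum_edge (M : zmodType) (G : 'I_m -> M) u i :
  (\sum_(r in u) G r = \sum_(r in u :\: [set i; ordS i]) G r
    + ((if i \in u then G i else 0) + (if ordS i \in u then G (ordS i) else 0)))%R.
Proof.
rewrite (big_setID [set i; ordS i]) /= addrC; congr (_ + _)%R.
rewrite (eq_bigl (fun r => (r \in [set i; ordS i]) && (r \in u))) => [|r]; last first.
  by rewrite inE andbC.
by rewrite big_mkcondr /= big_setU1 ?big_set1 //= inE (neq_ordS lam_proper).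
Qed.

(** Null sets with the single point [p] outside an edge force [W], once shifted to be 1 at [p], to
    vanish at the other points of the colour of [p] and to be constant on each run of points of
    other colours. [S] collects the places where this constant changes. *)
Lemma gale_normal_form p (W : 'I_m -> 'F_2) :
  (forall i u, p \notin [set i; ordS i] -> null lam u ->
     u :\: [set i; ordS i] = [set p] -> \sum_(r in u) W r = 1)%R ->
  exists z S, eset_of p S /\ forall r, gale lam p S r = (W r + omega z (lam r))%R.
Proof.
move=> W1; have [z0 z0p] := omega_surj (1 + W p)%R (lam_neq0 lam_proper p).
pose W' r := (W r + omega z0 (lam r))%R.
have W'p : W' p = 1%R by rewrite /W' z0p; case: (F2P (W p)) => ->; apply/eqP.
have W'1 i u : p \notin [set i; ordS i] -> null lam u ->
    u :\: [set i; ordS i] = [set p] -> (\sum_(r in u) W' r = 1)%R.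
  move=> pi u0 uE; rewrite big_split /= -omega_sum (W1 i u) //.
  by rewrite (eqP u0) omega0 addr0.
(* The null set meets the edge in a subset of colour sum [lam p]: only [i] if [lam i] is that
   colour, both ends if neither end has it. The sum of [W'] over this subset is zero. *)
have edge i : p \notin [set i; ordS i] ->
    (lam i = lam p -> W' i = 0%R) /\ (lam i <> lam p -> lam (ordS i) <> lam p -> W' i = W' (ordS i)).
  move=> pi; have [|u u0 uE] := null_extend lam_proper (A := [set p]) (i := i).
    by rewrite disjoints1.
  have := W'1 i u pi u0 uE; have := u0; rewrite /null !(sum_edge _ u i) uE !big_set1 W'p addc_eq0.
  have lp := lam_neq0 lam_proper p; have lj := lam_neq0 lam_proper (ordS i).
  have lij := lam_ordS lam_proper i.
  move=> /eqP lpE; rewrite -[X in _ = X]addr0 => /addrI W'E; move: lpE W'E.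
  case: (i \in u); case: (ordS i \in u); rewrite ?addr0 ?add0r => lpE W'E; split.
  - by move=> e; move: lpE lj; rewrite e -[X in X = _]addr0 => /addrI <-; rewrite eqxx.
  - by move=> _ _; apply/eqP; rewrite -addF2_0 W'E.
  - by [].
  - by case.
  - by move=> e; rewrite e lpE eqxx in lij.
  - by move=> _ [].
  - by rewrite lpE eqxx in lp.
  - by rewrite lpE eqxx in lp.
have W'part r : r != p -> lam r = lam p -> W' r = 0%R.
  move=> rp lr; apply: (proj1 (edge r _) lr).
  rewrite !inE negb_or eq_sym rp /=; apply/negP=> /eqP pS.
  by have := lam_ordS lam_proper r; rewrite -pS lr eqxx.
(* U i is the value of W' on the arc of non-p-coloured points meeting {i, i + 1}. *)
pose U i := if lam i != lam p then W' i else W' (ordS i).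
have US i : lam (ordS i) != lam p -> U i = W' (ordS i).
  move=> lS; rewrite /U; case: ifPn => // li; apply: (proj2 (edge i _)); try exact/eqP.
  rewrite !inE negb_or; apply/andP; split; first by apply: contraNneq li => <-.
  by apply: contraNneq lS => <-.
pose S := [set s | U s != U (ord_pred s)].
have SE s : ((s \in S)%:R = U s + U (ord_pred s) :> 'F_2)%R.
  by rewrite inE -addF2_0 natF2_neq0.
have Sp : {in S, forall s, lam s = lam p}.
  move=> s; rewrite inE => Us; apply/eqP; apply: contraNT Us => ls.
  by rewrite (US (ord_pred s)) ord_predK // /U ls.
pose o : 'I_m := Ordinal (ltn_trans (isT : 0 < 2) m_gt2).
(* The changes of [U] telescope from 0 to [i]; [ord_pred o] is the last index. *)
have count k (i : 'I_m) : val i = k ->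
    ((odd #|[set s in S | (s < i.+1)%N]|)%:R = U i + U (ord_pred o) :> 'F_2)%R.
  elim: k i => [|k IH] i ik; rewrite odd_card_leq natF2_addb SE.
    have -> : i = o by apply: val_inj.
    rewrite /side (_ : [set s in S | s < o] = set0) ?cards0 ?add0r //.
    by apply/setP=> s; rewrite !inE andbF.
  have km : k < m by move: (ltn_ord i); rewrite ik; apply: ltnW.
  have -> : ord_pred i = Ordinal km.
    by rewrite -[Ordinal km]ordSK; congr ord_pred; apply: val_inj; rewrite /= modn_small ?ik // -ik ltn_ord.
  have := IH (Ordinal km) erefl; rewrite /side ik /= => ->.
  by case: (F2P (U i)) => ->; case: (F2P (U (Ordinal km))) => ->; case: (F2P (U (ord_pred o))) => ->; apply/eqP.
have evS : ~~ odd #|S|.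
  (* At the last index all of [S] is counted and the two values of [U] cancel. *)
  have := count _ (ord_pred o) erefl; rewrite (_ : [set s in S | _] = S); last first.
    apply/setP=> s; rewrite !inE; have := ltn_ord s => sm.
    by rewrite [s < _](_ : _ = true) ?andbT //= add0n modn_small; lia.
  by case: (odd _) => //; case: (F2P (U (ord_pred o))) => ->.
have sideE i : ((side S (ordS i))%:R = U i + U (ord_pred o) :> 'F_2)%R.
  by rewrite side_ordS // -odd_card_leq (count _ i erefl).
(* [gale] has value 0 on the side of 0, so if [U] is 1 at the last index, all points not coloured
   like [p] must be flipped, which is adding [lam p]. *)
pose z : color := (z0 + if U (ord_pred o) == 0%R then 0 else lam p)%R.
have zE r : omega z (lam r) = (omega z0 (lam r) + U (ord_pred o) * (lam p != lam r)%:R)%R.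
  rewrite omegaDl; congr (_ + _)%R; case: (F2P (U (ord_pred o))) => ->.
    by rewrite eqxx mul0r omegaC omega0.
  by rewrite oner_eq0 mul1r omega_lam.
exists z, S; split=> // r; rewrite zE addrA -/(W' r) /gale omega_lam //.
have [->|rp] := eqVneq r p; first by rewrite W'p eqxx mulr0 mul0r.
have [lr|lr] := eqVneq (lam p) (lam r); first by rewrite mul0r mulr0 W'part.
by rewrite mul1r mulr1 add0r -[r]ord_predK sideE US ord_predK 1?eq_sym.
Qed.

Lemma good_normal_form V : good V ->
  exists (z : Idx J -> color) E, (forall a, eset_of (tag a) (E a)) /\
    forall a r, (gale lam (tag a) (E a) r = V a r + omega (z a) (lam r))%R.
Proof.
move=> gV; pose P a (zS : color * {set 'I_m}) := eset_of (tag a) zS.2 /\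
  forall r, (gale lam (tag a) zS.2 r = V a r + omega zS.1 (lam r))%R.
have [a|zS zSP] := @fin_all_exists (Idx J) (fun _ => _) P.
  have [|z [S zSP]] := @gale_normal_form (tag a) (V a); last by exists (z, S).
  by move=> i u ai u0 uE; apply: good_row uE.
exists (fun a => (zS a).1), [ffun a => (zS a).2].
by split=> a; have [eS gS] := zSP a; rewrite ffunE.
Qed.

(** The side of [S] changes at [x], so one of the two edges at [x] is cut off from [q] by [S]; the
    side of [T] does not change there, so [T] cuts off either edge from [p]. *)
Lemma separating_edge_in p q S T x : lam p != lam q ->
  eset_of p S -> eset_of q T -> x \in S -> x \notin T -> side T x != side T p ->
  exists i, [/\ p \notin [set i; ordS i], q \notin [set i; ordS i],
    side S q != side S (ordS i) & side T p != side T (ordS i)].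
Proof.
move=> lpq [evS Sp] [evT Tq] xS xT Txp; have lx := Sp x xS.
have px : p != x by apply: contraNneq Txp => ->.
have qx : q != x by apply: contraNneq lpq => ->; rewrite lx.
have [Sq|Sq] := eqVneq (side S q) (side S (ordS x)).
  have lS := lam_ordS lam_proper (ord_pred x); rewrite ord_predK in lS.
  have Spx : side S (ord_pred x) = side S x.
    by apply: side_ord_pred => //; apply: contra lS => /Sp ->; rewrite lx.
  have Sqx : side S q != side S x by rewrite Sq side_ordS // xS; case: (side S x).
  exists (ord_pred x); rewrite !inE ord_predK !negb_or px qx; split=> //.
  - by rewrite andbT; apply: contra lS => /eqP <-; rewrite lx.
  - by rewrite andbT; apply: contra Sqx => /eqP ->; rewrite Spx.
  - by rewrite eq_sym.
exists x; rewrite !inE !negb_or px qx; split=> //.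
- by apply: contra (lam_ordS lam_proper x) => /eqP <-; rewrite lx.
- by apply: contra Sq => /eqP <-.
- by rewrite side_ordS // (negPf xT) addbF eq_sym.
Qed.

Lemma separating_edge p q S T x : lam p != lam q ->
  eset_of p S -> eset_of q T -> x \in Omega q S -> x \in Omega p T ->
  exists i, [/\ p \notin [set i; ordS i], q \notin [set i; ordS i],
    side S q != side S (ordS i) & side T p != side T (ordS i)].
Proof.
move=> lpq eS eT; have [evS Sp] := eS; have [evT Tq] := eT.
have qS : q \notin S by apply: contra lpq => /Sp ->.
have pT : p \notin T by apply: contra lpq => /Tq ->.
rewrite !Omega_side //; case: (boolP (x \in S)) => /= [xS _|xS Sxq].
  have xT : x \notin T by apply: contra lpq => xT; rewrite -(Tq x xT) (Sp x xS).
  by rewrite (negPf xT) => Txp; apply: separating_edge_in Txp.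
case: (boolP (x \in T)) => /= [xT _|xT Txp].
  have lqp : lam q != lam p by rewrite eq_sym.
  by have [i [qi pi Ti Si]] := separating_edge_in lqp eT eS xT xS Sxq; exists i.
exists x; rewrite !inE !negb_or !side_ordS // (negPf xS) (negPf xT) !addbF; split; rewrite 1?eq_sym //.
- apply/andP; split; first by apply: contraNneq Txp => ->.
  by apply: contraNneq Txp => ->; rewrite side_ordS // (negPf xT) addbF.
- apply/andP; split; first by apply: contraNneq Sxq => ->.
  by apply: contraNneq Sxq => ->; rewrite side_ordS // (negPf xS) addbF.
Qed.

(** A common point of the two sets yields an edge with a 2-cycle. A null set with exactly [tag a]
    and [tag b] outside that edge then has both sums equal to 1 + 1 = 0, so its full part lies in
    the edge. *)
Lemma good_disjoint_Omega E : (forall a, eset_of (tag a) (E a)) ->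
  good (fun a => gale lam (tag a) (E a)) ->
  forall a b, disjoint_Omega (tag a) (E a) (tag b) (E b).
Proof.
move=> evE gE a b lab _ _; apply/setP=> x; rewrite inE in_set0; apply/negP=> /andP[xa xb].
have [i [ai bi Ea Eb]] := separating_edge lab (evE a) (evE b) xa xb.
have [|u u0 uE] := null_extend lam_proper (A := [set tag a; tag b]) (i := i).
  by rewrite disjoints_subset subUset !sub1set !inE in ai bi *; rewrite ai bi.
have [au bu] : tag a \in u /\ tag b \in u.
  have sub : [set tag a; tag b] \subset u by rewrite -uE subsetDl.
  by split; apply: (subsetP sub); rewrite !inE eqxx ?orbT.
have un0 : u != set0 by apply/set0Pn; exists (tag a).
have ab : tag a != tag b by apply: contraNneq lab => ->.
apply: (negP (gE u un0 u0)); apply/(Pm_faceP m_gt2); exists i; apply: full_sub_edge => r.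
have [[evA Aa] [evB Bb]] := (evE a, evE b).
rewrite uE !inE => /orP[]/eqP ->.
  exists a => //; rewrite (gale_sum lam_proper i u0) // uE au big_setU1 ?inE //= big_set1.
  by rewrite eqxx lab Ea.
exists b => //; rewrite (gale_sum lam_proper i u0) // uE bu big_setU1 ?inE //= big_set1.
by rewrite eqxx [lam (tag b) == _]eq_sym lab Eb.
Qed.

End Good.

(** Coefficients in F_2 are 0 or 1, so a linear relation is a subset with zero sum. *)
Lemma free_F2P (T : finType) (vT : vectType 'F_2) (l : T -> vT) (t : {set T}) :
  reflect (forall u : {set T}, u \subset t -> (\sum_(v in u) l v = 0)%R -> u = set0)
    (free (map l (enum t))).
Proof.
have sumE (k : T -> 'F_2) : (\sum_(v in t) k v *: l v
    = \sum_(i < size (map l (enum t))) k (tnth (in_tuple (enum t)) (cast_ord (size_map _ _) i))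
        *: (in_tuple (map l (enum t)))`_i)%R.
  rewrite -big_enum big_tnth (reindex (cast_ord (size_map l (enum t)))) /=; last first.
    by exists (cast_ord (esym (size_map l (enum t)))) => j _; rewrite ?cast_ordK ?cast_ordKV.
  apply: eq_bigr => i _; congr (_ *: _)%R.
  have v0 : T := tnth (in_tuple (enum t)) (cast_ord (size_map _ _) i).
  by rewrite (tnth_nth v0) /= (nth_map v0) //; exact: (ltn_ord (cast_ord (size_map l (enum t)) i)).
apply: (iffP (freeP (X := in_tuple (map l (enum t))))) => [H u ut u0|H k k0 i].
  have sum0 : (\sum_(v in t) (v \in u)%:R *: l v = 0)%R.
    rewrite -[RHS]u0 [LHS](big_setID u) /= (setIidPr ut) [X in (_ + X)%R]big1 ?addr0 => [|v].
      by apply: eq_bigr => v ->; rewrite scale1r.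
    by rewrite inE => /andP[/negPf -> _]; rewrite scale0r.
  apply/setP=> v; rewrite inE; apply/negP=> vu; rewrite sumE in sum0.
  have vt : v \in enum t by rewrite mem_enum (subsetP ut).
  have vi : index v (enum t) < size (map l (enum t)) by rewrite size_map index_mem.
  have /eqP := H _ sum0 (Ordinal vi).
  by rewrite (tnth_nth v) /= nth_index // vu oner_eq0.
(* The coefficients [k], indexed by positions in [enum t], become a function on [T] that is 0
   outside [t]. *)
pose k' v : 'F_2 := if insub (index v (enum t)) is Some j then k j else 0%R.
have kE j : k' (tnth (in_tuple (enum t)) (cast_ord (size_map _ _) j)) = k j.
  have v0 : T := tnth (in_tuple (enum t)) (cast_ord (size_map _ _) j).
  have jt : j < size (enum t) := ltn_ord (cast_ord (size_map l (enum t)) j).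
  rewrite /k' (tnth_nth v0) /= index_uniq ?enum_uniq // insubT => [|jl]; first exact: ltn_ord.
  by congr k; apply: val_inj.
pose u := [set v in t | k' v == 1%R].
have u0 : u = set0.
  apply: H; first by apply/subsetP=> v; rewrite inE => /andP[].
  rewrite -[RHS]k0 -(eq_bigr _ (fun j _ => congr1 (fun c => c *: _)%R (kE j))) -sumE.
  rewrite big_mkcond [RHS]big_mkcond; apply: eq_bigr => v _; rewrite inE.
  by case: (v \in t) => //=; case: (F2P (k' v)) => ->; rewrite ?scale0r ?scale1r.
rewrite -kE; set v := tnth _ _; case: (F2P (k' v)) => // kv.
by have := in_set0 v; rewrite -u0 inE kv eqxx andbT -mem_enum (mem_tnth _ (in_tuple (enum t))).
Qed.

(** * Vertices, faces and kernels of maps over [P_m(J)] *)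

Section Wedge.
Variables (m : nat) (m_gt2 : 2 < m) (J : 'I_m -> nat).
Hypothesis J_gt0 : forall i, 0 < J i.
Implicit Types (i : 'I_m) (a b : Idx J) (v : VJ J).

Lemma wedge_vertex_subproof a : (tagged a).+1 < J (tag a).
Proof. by rewrite -ltn_predRL; apply: ltn_ord. Qed.

(* Index 0 over each i is taken by inl i, so the indices of the vertices inr a are shifted by one. *)
Definition vertex (x : 'I_m + Idx J) : VJ J :=
  match x with
  | inl i => Tagged (fun i => 'I_(J i)) (Ordinal (J_gt0 i))
  | inr a => Tagged (fun i => 'I_(J i)) (Ordinal (wedge_vertex_subproof a))
  end.

Definition vertex_inv v : 'I_m + Idx J := odflt (inl (tag v)) [pick x | vertex x == v].

Lemma vertex_inj : injective vertex.
Proof.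
move=> [i|[i [k kl]]] [j|[j [k' kl']]] e; have /= ij := congr1 tag e; subst j => //;
  move/eqP: e; rewrite eq_Tagged -val_eqE //= => /eqP [].
by move=> kk; congr (inr (Tagged _ _)); apply: val_inj.
Qed.

Lemma vertex_invK : cancel vertex_inv vertex.
Proof.
move=> v; rewrite /vertex_inv; case: pickP => [x /eqP //|] H.
case: v H => i [[|k] ki] H.
  by move/eqP: (H (inl i)); case; congr (Tagged _ _); apply: val_inj.
have ki' : k < (J i).-1 by rewrite ltn_predRL.
move/eqP: (H (inr (Tagged (fun i => 'I_(J i).-1) (Ordinal ki')))); case.
by congr (Tagged _ _); apply: val_inj.
Qed.

Lemma vertexK : cancel vertex vertex_inv.
Proof. by move=> x; apply: vertex_inj; rewrite vertex_invK. Qed.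

Definition base (u : {set VJ J}) := [set i | vertex (inl i) \in u].
Definition extra (u : {set VJ J}) := [set a | vertex (inr a) \in u].

Lemma sum_vertex (M : zmodType) (F : VJ J -> M) (u : {set VJ J}) :
  (\sum_(v in u) F v = \sum_(i in base u) F (vertex (inl i))
     + \sum_(a in extra u) F (vertex (inr a)))%R.
Proof.
rewrite (reindex vertex) /=; last by exists vertex_inv => x _; rewrite ?vertexK ?vertex_invK.
rewrite big_sumType /=; congr (_ + _)%R; by apply: eq_bigl => x; rewrite inE.
Qed.

(** All vertices over [w] lie in [u] iff [w] is contained in the set of points whose vertices all
    lie in [u]; and a set is a face of [P_m] iff it contains no minimal non-face. *)
Lemma PmJ_faceE (u : {set VJ J}) :
  PmJ_face u = Pm_face [set i in base u | [forall a, (tag a == i) ==> (a \in extra u)]].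
Proof.
set F := [set i in _ | _].
have FP (w : {set 'I_m}) : ([set v : VJ J | tag v \in w] \subset u) = (w \subset F).
  apply/subsetP/subsetP=> H x.
    move=> xw; rewrite !inE H ?inE //=; apply/forallP=> a; apply/implyP=> /eqP ax.
    by rewrite inE H // inE /= ax.
  rewrite -[x]vertex_invK inE; case: (vertex_inv x) => [i|a] /= /H; rewrite !inE; first by case/andP.
  by case/andP=> _ /forallP/(_ a); rewrite eqxx inE.
have down (w w' : {set 'I_m}) : w \subset w' -> Pm_face w' -> Pm_face w.
  move=> ww' /(Pm_faceP m_gt2)[i w'i]; apply/(Pm_faceP m_gt2).
  by exists i; apply: subset_trans w'i.
apply/forallP/idP => [H|FF w]; last first.
  apply/implyP=> /andP[nw _]; rewrite FP; apply: contra nw => wF; exact: down FF.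
apply: contraT => nF; have [w /minsetP[nw wmin] wF] := minset_exists (P := fun s => ~~ Pm_face s) nF.
have := H w; rewrite FP wF implybF /min_nonface nw /= negb_forall => /existsP[x].
rewrite negb_imply => /andP[xw nx]; have := wmin _ nx (subsetDl _ _).
by move=> e; move: xw; rewrite -e !inE eqxx.
Qed.

Lemma charmapP (l : {ffun VJ J -> 'rV['F_2]_(nJ J)}) :
  reflect (forall u : {set VJ J}, PmJ_face u -> (\sum_(v in u) l v = 0)%R -> u = set0)
    (charmap l).
Proof.
apply: (iffP forallP) => [H u fu|H t].
  by have /implyP/(_ fu)/free_F2P := H u; apply.
apply/implyP=> ft; apply/free_F2P=> u ut; apply: H.
move: ft; rewrite !PmJ_faceE => /(Pm_faceP m_gt2)[i ti]; apply/(Pm_faceP m_gt2).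
exists i; apply: subset_trans ti; apply/subsetP=> r; rewrite !inE => /andP[/(subsetP ut)-> /=].
move=> /forallP au; apply/forallP=> a; apply/implyP=> ar.
by have := au a; rewrite ar !inE => /(subsetP ut).
Qed.

(** Two coordinates serve the plane of colours, and one serves each additional vertex. *)
Lemma card_coordinates : #|{: bool + Idx J}| = nJ J.
Proof.
rewrite card_sum card_bool card_tagged sumnE big_map big_enum /= /nJ add2n.
by congr _.+2; apply: eq_bigr => i _; rewrite card_ord.
Qed.

Definition pos (y : bool + Idx J) : 'I_(nJ J) := cast_ord card_coordinates (enum_rank y).
Definition at_pos (j : 'I_(nJ J)) : bool + Idx J :=
  enum_val (cast_ord (esym card_coordinates) j).

Lemma posK : cancel pos at_pos.
Proof. by move=> y; rewrite /at_pos cast_ordK enum_rankK. Qed.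

Lemma at_posK : cancel at_pos pos.
Proof. by move=> y; rewrite /pos enum_valK cast_ordKV. Qed.

Local Open Scope ring_scope.

Section Standard.
Variables (lam : 'I_m -> color) (V : Idx J -> 'I_m -> 'F_2).

Definition standard_entry (x : 'I_m + Idx J) (y : bool + Idx J) : 'F_2 :=
  match x, y with
  | inl i, inl c => if c then (lam i).1 else (lam i).2
  | inl i, inr a => V a i
  | inr b, inl _ => 0
  | inr b, inr a => (b == a)%:R
  end.

(* The D-J class with Gale dual V: the new vertices are mapped to basis vectors. *)
Definition standard : {ffun VJ J -> 'rV['F_2]_(nJ J)} :=
  [ffun v => \row_j standard_entry (vertex_inv v) (at_pos j)].

Lemma standardE x y : standard (vertex x) 0 (pos y) = standard_entry x y.
Proof. by rewrite ffunE mxE vertexK posK. Qed.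

Lemma sum_standard (u : {set VJ J}) y :
  (\sum_(v in u) standard v) 0 (pos y) =
  match y with
  | inl c => if c then (\sum_(i in base u) lam i).1 else (\sum_(i in base u) lam i).2
  | inr a => \sum_(i in base u) V a i + (a \in extra u)%:R
  end.
Proof.
rewrite summxE sum_vertex.
under eq_bigr do rewrite standardE.
under [X in _ + X]eq_bigr do rewrite standardE.
case: y => [c|a] /=; last by rewrite sum_eqF2.
rewrite [X in _ + X]big1 // addr0; case: c.
  exact: (esym (raddf_sum (@fst 'F_2 'F_2) _ _ _)).
exact: (esym (raddf_sum (@snd 'F_2 'F_2) _ _ _)).
Qed.

(** The two colour coordinates make the base null, and the coordinate of [a] decides whether the
    vertex of [a] belongs to [u]; so a kernel set is determined by its base. *)
Lemma standard_kernel (u : {set VJ J}) :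
  \sum_(v in u) standard v = 0 <->
  null lam (base u) /\ forall a, (a \in extra u) = (\sum_(i in base u) V a i == 1).
Proof.
split=> [u0|[/eqP b0 ext]].
  have e y : (\sum_(v in u) standard v) 0 (pos y) = 0 by rewrite u0 mxE.
  split=> [|a]; last first.
    by have := e (inr a); rewrite sum_standard; case: (a \in _); case: (F2P (\sum_(i in base u) V a i)) => -> // /eqP.
  have e1 := e (inl true); have e2 := e (inl false); rewrite !sum_standard in e1 e2.
  by rewrite /null [X in X == _]surjective_pairing e1 e2.
apply/rowP=> j; rewrite -[j]at_posK mxE sum_standard; case: (at_pos j) => [c|a].
  by rewrite b0; case: c.
by rewrite ext; case: (F2P (\sum_(i in base u) V a i)) => ->; apply/eqP.
Qed.

Lemma exists_kernel (w : {set 'I_m}) : null lam w ->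
  exists u : {set VJ J}, base u = w /\ \sum_(v in u) standard v = 0.
Proof.
move=> w0; pose u := [set v | match vertex_inv v with
  | inl i => i \in w | inr a => \sum_(i in w) V a i == 1 end].
have bu : base u = w by apply/setP=> i; rewrite !inE vertexK.
by exists u; split=> //; apply/standard_kernel; rewrite bu; split=> // a; rewrite !inE vertexK.
Qed.

Lemma standard_face (u : {set VJ J}) : \sum_(v in u) standard v = 0 ->
  PmJ_face u = Pm_face (full V (base u)).
Proof.
move/standard_kernel => [_ ext]; rewrite PmJ_faceE; congr Pm_face.
apply/setP=> i; rewrite !inE; congr (_ && _).
by apply: eq_forallb => a; rewrite ext.
Qed.

Lemma standard_charmap : charmap standard <-> good lam V.
Proof.
split=> [/charmapP H w wn0 /exists_kernel[u [bu u0]]|gV].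
  apply/negP; rewrite -bu -standard_face // => /H /(_ u0) ue.
  by move: wn0; rewrite -bu ue => /set0Pn[i]; rewrite !inE.
apply/charmapP=> u fu u0; move: fu; rewrite standard_face //.
have [b0 ext] := proj1 (standard_kernel u) u0.
have [be _|/gV/(_ b0)/negPf-> //] := eqVneq (base u) set0.
apply/setP=> v; rewrite inE -[v]vertex_invK; case: (vertex_inv v) => [i|a].
  by have := in_set0 i; rewrite -be inE.
by have := ext a; rewrite be big_set0 inE.
Qed.

End Standard.

Lemma dj_equiv_sym (l l' : {ffun VJ J -> 'rV['F_2]_(nJ J)}) : dj_equiv l l' -> dj_equiv l' l.
Proof.
move=> /existsP[A /andP[uA /forallP H]]; apply/existsP; exists (invmx A).
by rewrite unitmx_inv uA; apply/forallP=> v; rewrite (eqP (H v)) mulmxK.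
Qed.

Lemma dj_equiv_trans (l2 l1 l3 : {ffun VJ J -> 'rV['F_2]_(nJ J)}) :
  dj_equiv l1 l2 -> dj_equiv l2 l3 -> dj_equiv l1 l3.
Proof.
move=> /existsP[A /andP[uA /forallP HA]] /existsP[B /andP[uB /forallP HB]].
apply/existsP; exists (A *m B); rewrite unitmx_mul uA uB.
by apply/forallP=> v; rewrite (eqP (HB v)) (eqP (HA v)) mulmxA.
Qed.

Lemma dj_equiv_refl (l : {ffun VJ J -> 'rV['F_2]_(nJ J)}) : dj_equiv l l.
Proof.
by apply/existsP; exists 1%:M; rewrite unitmx1; apply/forallP=> v; rewrite mulmx1.
Qed.

Lemma dj_equiv_kernel (l l' : {ffun VJ J -> 'rV['F_2]_(nJ J)}) (u : {set VJ J}) :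
  dj_equiv l l' -> \sum_(v in u) l v = 0 -> \sum_(v in u) l' v = 0.
Proof.
move=> /existsP[A /andP[_ /forallP H]] u0.
by rewrite (eq_bigr _ (fun v _ => eqP (H v))) -mulmx_suml u0 mul0mx.
Qed.

Lemma dj_equiv_charmap (l l' : {ffun VJ J -> 'rV['F_2]_(nJ J)}) :
  dj_equiv l l' -> charmap l -> charmap l'.
Proof.
move=> ll' /charmapP H; apply/charmapP=> u fu u0; apply: H => //.
exact: dj_equiv_kernel (dj_equiv_sym ll') u0.
Qed.

(** The change of basis adds multiples of the two colour coordinates to the coordinate of each [a].
    Its nilpotent part [N] has square zero, so [1 - N] is the inverse. *)
Lemma standard_shift lam V V' (z : Idx J -> color) :
  (forall a r, V' a r = V a r + omega (z a) (lam r)) ->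
  dj_equiv (standard lam V) (standard lam V').
Proof.
move=> VV'; pose N : 'M['F_2]_(nJ J) := \matrix_(j, k) match at_pos j, at_pos k with
  | inl c, inr a => if c then (z a).2 else (z a).1 | _, _ => 0 end.
have N2 : N *m N = 0.
  apply/matrixP=> j k; rewrite !mxE big1 // => r _; rewrite !mxE.
  by case: (at_pos j) => ?; case: (at_pos r) => ?; rewrite ?mulr0 ?mul0r.
apply/existsP; exists (1%:M + N); apply/andP; split.
  have /mulmx1_unit[] // : (1%:M + N) *m (1%:M - N) = 1%:M.
  by rewrite mulmxDl mul1mx mulmxBr mulmx1 N2 subr0 subrK.
apply/forallP=> v; apply/eqP/rowP=> j; rewrite -[v]vertex_invK -[j]at_posK.
move: (vertex_inv v) (at_pos j) => x y.
rewrite mulmxDr mulmx1 mxE !standardE mxE.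
rewrite (reindex pos) /=; last by exists at_pos => k _; rewrite ?posK ?at_posK.
under eq_bigr do rewrite standardE mxE !posK.
rewrite big_sumType /= big_bool [X in _ + (_ + X)]big1 ?addr0 => [|a _]; last by rewrite mulr0.
case: x y => [i|b] [c|a] /=; rewrite ?mulr0 ?mul0r ?addr0 //.
by rewrite VV' /omega; congr (_ + _); rewrite [LHS]addrC [X in X + _]mulrC [X in _ + X]mulrC.
Qed.

End Wedge.

(** * From characteristic maps to pairs and back *)

Section Classification.
Variables (m : nat) (m_gt2 : 2 < m) (J : 'I_m -> nat).
Hypothesis J_gt0 : forall i, 0 < J i.
Implicit Types (i r : 'I_m) (a b : Idx J) (v : VJ J).
Local Open Scope ring_scope.

Let vertex := vertex J_gt0.
Let o : 'I_m := Ordinal (ltn_trans (isT : (0 < 2)%N) m_gt2).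

(** The chosen vertices over [o] and [ordS o], together with all additional vertices, form a facet.
    Its images are a basis, in which the map has standard form. *)
Lemma charmap_standard (l : {ffun VJ J -> 'rV['F_2]_(nJ J)}) : charmap l ->
  exists lam V, [/\ dj_equiv (standard J_gt0 lam V) l, lam o = (1, 0) & lam (ordS o) = (0, 1)].
Proof.
move=> /(charmapP m_gt2 J_gt0) l_char.
pose facet (y : bool + Idx J) : VJ J :=
  match y with inl c => vertex (inl (if c then o else ordS o)) | inr a => vertex (inr a) end.
have oS : o != ordS o.
  by apply/negP=> /eqP e; have := ordS_ordS m_gt2 o; rewrite -!e eqxx.
have facet_inj : injective facet.
  move=> [c|a] [d|b] /(@vertex_inj m J J_gt0) // [].
    by case: c d => [] [] //= e; case/eqP: oS.
  by move=> ->.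
pose B : 'M['F_2]_(nJ J) := \matrix_j l (facet (at_pos j)).
have uB : B \in unitmx.
  rewrite -row_free_unit; apply: inj_row_free => c cB.
  pose u := [set facet (at_pos j) | j in [set j | c 0 j != 0]].
  have u0 : u = set0.
    apply: l_char; last first.
      rewrite big_imset /=; last by move=> j k _ _ /facet_inj /(can_inj (@at_posK m J)).
      rewrite -[RHS]cB mulmx_sum_row big_mkcond; apply: eq_bigr => j _.
      by rewrite inE rowK; case: (F2P (c 0 j)) => ->; rewrite ?scale0r ?scale1r.
    rewrite (PmJ_faceE m_gt2 J_gt0); apply/(Pm_faceP m_gt2); exists o.
    apply/subsetP=> i; rewrite inE => /andP[+ _]; rewrite inE => /imsetP[j _].
    case: (at_pos j) => [d|a] /(@vertex_inj m J J_gt0) // [->].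
    by rewrite !inE; case: d; rewrite eqxx ?orbT.
  apply/rowP=> j; rewrite mxE; apply/eqP/negPn/negP=> cj.
  have : facet (at_pos j) \in u by apply/imsetP; exists j; rewrite ?inE.
  by rewrite u0 inE.
pose l' v := l v *m invmx B.
have l'E y k : l' (facet y) 0 k = (pos y == k)%:R.
  rewrite /l' -[l _](_ : row (pos y) B = _); last by rewrite rowK posK.
  by rewrite -row_mul mulmxV // row1 mxE eqxx eq_sym.
pose lam i : color := (l' (vertex (inl i)) 0 (pos (inl true)), l' (vertex (inl i)) 0 (pos (inl false))).
pose V a i := l' (vertex (inl i)) 0 (pos (inr a)).
have posE (x y : bool + Idx J) : (pos x == pos y) = (x == y) := can_eq (@posK m J) x y.
exists lam, V; split.
- apply/existsP; exists B; rewrite uB; apply/forallP=> v.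
  suff -> : standard J_gt0 lam V v = l' v by rewrite /l' mulmxKV.
  apply/rowP=> j; rewrite -[v](vertex_invK J_gt0) -[j]at_posK standardE.
  case: (vertex_inv J_gt0 v) => [i|b]; case: (at_pos j) => [c|a] //=.
  + by case: c.
  + by rewrite (l'E (inr b)) posE.
  + by rewrite (l'E (inr b)) posE.
- by rewrite /lam (l'E (inl true)) (l'E (inl true)) !posE.
- by rewrite /lam (l'E (inl false)) (l'E (inl false)) !posE.
Qed.

Lemma standard_ext lam lam' (V V' : Idx J -> 'I_m -> 'F_2) :
  lam =1 lam' -> (forall a, V a =1 V' a) -> standard J_gt0 lam V = standard J_gt0 lam' V'.
Proof.
move=> e e'; apply/ffunP=> v; apply/rowP=> j.
rewrite -[v](vertex_invK J_gt0) -[j]at_posK !standardE.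
by case: (vertex_inv J_gt0 v) => [i|b]; case: (at_pos j) => [c|a] //=; rewrite ?e ?e'.
Qed.

Section Partition.
Variables (P : {set {set 'I_m}}) (lam : 'I_m -> color).
Hypothesis lamP : forall p q, (lam p == lam q) = lequiv P p q.

Lemma eset_compatP p S : reflect (eset_of lam p S) (eset_compat P p S).
Proof.
apply: (iffP andP) => [[evS /forall_inP H]|[evS Sp]]; split=> //.
  move=> s sS; apply/eqP; rewrite lamP.
  by apply: (forall_inP (H s _)); rewrite !inE ?eqxx ?sS ?orbT.
have Sp' x : x \in p |: S -> lam x = lam p by rewrite !inE => /orP[/eqP ->|/Sp].
by apply/forall_inP=> x /Sp' ex; apply/forall_inP=> y /Sp' ey; rewrite -lamP ex ey.
Qed.

Lemma lrelatedP p S q T : reflect (disjoint_Omega lam p S q T) (lrelated P p S q T).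
Proof.
rewrite /lrelated /disjoint_Omega -lamP.
case: (eqVneq (lam p) (lam q)) => _; first by rewrite /= !orbT; left.
case: (eqVneq S set0) => _ /=; first by left.
case: (eqVneq T set0) => _ /=; first by left.
by apply: (iffP eqP) => // H; apply: H.
Qed.

Lemma DJpairP (E : {ffun Idx J -> {set 'I_m}}) : Pm_class P -> reflect
  ((forall a, eset_of lam (tag a) (E a)) /\
   (forall a b, disjoint_Omega lam (tag a) (E a) (tag b) (E b)))
  (@DJpair m J (P, E)).
Proof.
move=> clP; rewrite /DJpair clP /=; apply: (iffP andP) => -[H1 H2]; split.
- by move=> a; apply/eset_compatP; apply: (forallP H1).
- move=> a b; have [->|ab] := eqVneq a b; first by rewrite /disjoint_Omega eqxx.
  by apply/lrelatedP; have /forallP/(_ b) := forallP H2 a; rewrite ab.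
- by apply/forallP=> a; apply/eset_compatP.
- by apply/forallP=> a; apply/forallP=> b; apply/implyP=> _; apply/lrelatedP.
Qed.

End Partition.

Lemma lequiv_pblock (P : {set {set 'I_m}}) p q :
  partition P [set: 'I_m] -> lequiv P p q = (q \in pblock P p).
Proof.
move=> /and3P[/eqP cP tP _]; apply/exists_inP/idP => [[B BP /andP[pB qB]]|qp].
  by rewrite (def_pblock tP BP pB).
exists (pblock P p); first by rewrite pblock_mem // cP inE.
by rewrite qp mem_pblock cP inE.
Qed.

Lemma lequiv_preim (lam : 'I_m -> color) p q : lequiv (preim_partition lam [set: 'I_m]) p q = (lam p == lam q).
Proof.
rewrite lequiv_pblock ?preim_partitionP // pblock_equivalence_partition ?inE //.
by move=> x y z _ _ _; split=> // /eqP ->.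
Qed.

Lemma Pm_class_preim (lam : 'I_m -> color) : proper_coloring lam -> Pm_class (preim_partition lam [set: 'I_m]).
Proof.
move=> lam_proper; apply/and3P; split; first exact: preim_partitionP.
  pose nz : {set color} := [set~ (0, 0)].
  have <- : #|nz| = 3%N by rewrite cardsC1 card_prod !card_ord.
  apply: leq_trans (leq_imset_card (fun c : color => [set y | c == lam y]) nz).
  apply/subset_leq_card/subsetP=> B /imsetP[x _ ->].
  apply/imsetP; exists (lam x); first by rewrite !inE (lam_neq0 lam_proper).
  by apply/setP=> y; rewrite !inE.
apply/forall_inP=> B BP; apply/forallP=> i; apply/forallP=> j; apply/negP=> /and3P[iB jB /eqP ji].
have : lequiv (preim_partition lam [set: 'I_m]) i j by apply/exists_inP; exists B; rewrite ?iB.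
by rewrite lequiv_preim (_ : j = ordS i) ?(negPf (lam_ordS lam_proper i)) //; apply: val_inj.
Qed.

(* The colouring attached to a class over P_m, normalised on the edge {0, 1}. *)
Definition class_color (P : {set {set 'I_m}}) r : color :=
  if lequiv P o r then (1, 0) else if lequiv P (ordS o) r then (0, 1) else (1, 1).

Lemma class_colorP P p q : Pm_class P -> (class_color P p == class_color P q) = lequiv P p q.
Proof.
move=> /and3P[pP P3 /forall_inP Pnc]; have [/eqP cP tP _] := and3P pP.
have inP r : r \in cover P by rewrite cP inE.
have eqE x y : lequiv P x y = (pblock P x == pblock P y).
  by rewrite lequiv_pblock // eq_pblock.
have oS : pblock P o != pblock P (ordS o).
  apply/negP=> e; have := Pnc (pblock P o) (pblock_mem (inP o)).
  move=> /forallP/(_ o)/forallP/(_ (ordS o)); rewrite mem_pblock inP -eq_pblock // e /=.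
  by rewrite eqxx.
rewrite /class_color !eqE.
case: (eqVneq (pblock P o) (pblock P p)) => [e|op].
  rewrite -e; case: (eqVneq (pblock P o) (pblock P q)) => [_|_]; first by rewrite eqxx.
  by case: ifP.
case: (eqVneq (pblock P o) (pblock P q)) => [<-|oq].
  by rewrite [RHS]eq_sym (negPf op); case: ifP.
case: (eqVneq (pblock P (ordS o)) (pblock P p)) => [e'|Sp].
  by rewrite -e'; case: (eqVneq (pblock P (ordS o)) (pblock P q)).
case: (eqVneq (pblock P (ordS o)) (pblock P q)) => [<-|Sq].
  by rewrite [RHS]eq_sym (negPf Sp).
(* Both points lie outside the parts of [o] and [ordS o]; if they were not equivalent, there would
   be four parts. *)
rewrite eqxx; apply/esym/negPn/negP=> pq.
have : uniq [:: pblock P o; pblock P (ordS o); pblock P p; pblock P q].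
  by rewrite /= !inE !negb_or oS op oq Sp Sq pq.
move=> /uniq_leq_size H; suff /H : {subset [:: pblock P o; pblock P (ordS o); pblock P p; pblock P q] <= enum P}.
  by rewrite -cardE leqNgt ltnS P3.
by move=> B; rewrite !inE mem_enum => /or4P[]/eqP ->; apply: pblock_mem.
Qed.

Lemma class_color_proper P : Pm_class P -> proper_coloring (class_color P).
Proof.
move=> clP i; split; first by rewrite /class_color; do 2?case: ifP.
rewrite class_colorP //; have /and3P[_ _ /forall_inP Pnc] := clP.
apply/negP=> /exists_inP[B BP /andP[iB SB]].
by have := Pnc B BP => /forallP/(_ i)/forallP/(_ (ordS i)); rewrite iB SB eqxx.
Qed.

Definition charmap_of_pair (x : {set {set 'I_m}} * {ffun Idx J -> {set 'I_m}}) :=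
  standard J_gt0 (class_color x.1) (fun a => gale (class_color x.1) (tag a) (x.2 a)).

Lemma DJset_spec x : x \in DJset J -> [/\ Pm_class x.1,
   (forall a, eset_of (class_color x.1) (tag a) (x.2 a)) &
   (forall a b, disjoint_Omega (class_color x.1) (tag a) (x.2 a) (tag b) (x.2 b))].
Proof.
case: x => P E; rewrite inE => xP; have clP : Pm_class P by case/and3P: xP.
by have [] := elimT (DJpairP (fun p q => class_colorP p q clP) E clP) xP.
Qed.

Lemma charmap_of_pair_charmap x : x \in DJset J -> charmap (charmap_of_pair x).
Proof.
move=> /DJset_spec[clP eE dE]; apply/standard_charmap => //.
by apply: good_gale => //; apply: class_color_proper.
Qed.

Lemma charmap_of_pair_surj l : charmap l ->
  exists2 x, x \in DJset J & dj_equiv (charmap_of_pair x) l.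
Proof.
move=> l_char; have [lam [V [lV lo lS]]] := charmap_standard l_char.
have gV : good lam V.
  by apply/(standard_charmap m_gt2 J_gt0); apply: dj_equiv_charmap (dj_equiv_sym lV) l_char.
have lam_proper := good_coloring m_gt2 gV.
have [z [E [eE gE]]] := good_normal_form m_gt2 lam_proper gV.
pose P := preim_partition lam [set: 'I_m].
have clP : Pm_class P := Pm_class_preim lam_proper.
(* The values on the edge are already normalised, and the third nonzero colour can only be
   [(1, 1)]. *)
have lamE r : class_color P r = lam r.
  rewrite /class_color !lequiv_preim lo lS; have := lam_neq0 lam_proper r.
  by case: (lam r) => c d; case: (F2P c) => ->; case: (F2P d) => ->.
exists (P, E).
  rewrite inE; apply/(DJpairP (lam := lam)) => //; first by move=> p q; rewrite lequiv_preim.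
  split=> //; apply: (good_disjoint_Omega m_gt2) => //.
  exact: good_shift gE gV.
have -> : charmap_of_pair (P, E) = standard J_gt0 lam (fun a => gale lam (tag a) (E a)).
  by apply: standard_ext => // a r; rewrite /gale /= !lamE.
by apply: dj_equiv_trans lV; apply: dj_equiv_sym; apply: standard_shift gE.
Qed.

Lemma null_pair (lam : 'I_m -> color) p q : p != q -> null lam [set p; q] = (lam p == lam q).
Proof. by move=> pq; rewrite /null big_setU1 ?inE //= big_set1 addc_eq0. Qed.

(** Equivalent maps have the same kernel sets. Null pairs recover the partition, and then the sums
    of the Gale vectors over null sets recover each e-set by [gale_inj]. *)
Lemma charmap_of_pair_inj x y : x \in DJset J -> y \in DJset J ->
  dj_equiv (charmap_of_pair x) (charmap_of_pair y) -> x = y.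
Proof.
have ker x' y' w : dj_equiv (charmap_of_pair x') (charmap_of_pair y') ->
    null (class_color x'.1) w -> null (class_color y'.1) w /\
    forall a, \sum_(r in w) gale (class_color x'.1) (tag a) (x'.2 a) r
            = \sum_(r in w) gale (class_color y'.1) (tag a) (y'.2 a) r.
  move=> xy w0.
  have [u [<- u0]] := exists_kernel J_gt0 (fun a => gale (class_color x'.1) (tag a) (x'.2 a)) w0.
  have [_ ex] := proj1 (standard_kernel _ _ _ _) u0.
  have [ny ey] := proj1 (standard_kernel _ _ _ _) (dj_equiv_kernel xy u0).
  by split=> // a; apply: F2_eq1; rewrite -ex -ey.
move=> /DJset_spec[clx ex _] /DJset_spec[cly ey _] xy.
have eP : x.1 = y.1.
  have [[px _ _] [py _ _]] := (and3P clx, and3P cly).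
  rewrite -(equivalence_partition_pblock px) -(equivalence_partition_pblock py).
  apply: eq_imset => p; apply/setP=> q; rewrite !inE /= -!lequiv_pblock // -!class_colorP //.
  have [->|pq] := eqVneq p q; first by rewrite !eqxx.
  rewrite -!null_pair //; apply/idP/idP => [/(ker _ _ _ xy)[]//|].
  by case/(ker _ _ _ (dj_equiv_sym xy)).
case: x y eP clx ex cly ey xy => [P E] [P' E'] /= <- clP eE _ eE' xy.
congr (_, _); apply/ffunP=> a; have [[evE Ep] [evE' Ep']] := (eE a, eE' a).
apply: (gale_inj (class_color_proper clP)) evE evE' Ep Ep' (ordS_ordS m_gt2) _.
by move=> u /(ker _ _ _ xy)[_ /(_ a)].
Qed.

Definition pair_class x := [set mu in charmaps J | dj_equiv (charmap_of_pair x) mu].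

Lemma pair_class_inj : {in DJset J &, injective pair_class}.
Proof.
move=> x y xJ yJ xy; apply: (charmap_of_pair_inj xJ yJ).
have : charmap_of_pair y \in pair_class y.
  by rewrite !inE dj_equiv_refl charmap_of_pair_charmap.
by rewrite -xy inE => /andP[].
Qed.

Lemma pair_class_image : pair_class @: DJset J = DJclasses J.
Proof.
apply/setP=> C; apply/imsetP/imsetP => [[x xJ ->]|[l]].
  by exists (charmap_of_pair x); rewrite // inE charmap_of_pair_charmap.
rewrite inE => /charmap_of_pair_surj[x xJ xl] ->; exists x; first exact: xJ.
apply/setP=> mu; rewrite !inE; apply: andb_id2l => _; apply/idP/idP => [lmu|xmu].
  exact: (dj_equiv_trans xl lmu).
exact: (dj_equiv_trans (dj_equiv_sym xl) xmu).
Qed.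

End Classification.

(** [pair_class] goes from pairs to D-J classes, while the theorem asks for a map from classes to
    pairs. *)
Lemma inverse_bijection (T U : finType) (y0 : T) (A : {set T}) (B : {set U}) (g : T -> U) :
  {in A &, injective g} -> g @: A = B ->
  exists f : U -> T, {in B &, injective f} /\ f @: B = A.
Proof.
move=> g_inj <-; pose f y := odflt y0 [pick x in A | g x == y].
have gK : {in A, cancel g f}.
  move=> x xA; rewrite /f; case: pickP => [x' /andP[x'A /eqP e]|/(_ x)]; last by rewrite xA eqxx.
  exact: g_inj.
exists f; split=> [_ _ /imsetP[x xA ->] /imsetP[y yA ->]|]; first by rewrite !gK // => ->.
by rewrite -imset_comp -[RHS]imset_id; apply: eq_in_imset => x /gK.
Qed.

Theorem mainTheorem7 (m : nat) (J : 'I_m -> nat) :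
  3 <= m -> (forall i, 0 < J i) ->
  exists f : {set {ffun VJ J -> 'rV['F_2]_(nJ J)}} ->
             {set {set 'I_m}} * {ffun Idx J -> {set 'I_m}},
    {in DJclasses J &, injective f} /\ f @: DJclasses J = DJset J.
Proof.
move=> m_gt2 J_gt0.
apply: inverse_bijection (@pair_class_inj m m_gt2 J J_gt0) (pair_class_image m_gt2 J_gt0).
exact: (set0, [ffun=> set0]).
Qed.
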